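(* Let $\mathcal{T}$ be an arbitrary finite tree with vertex set $\mathcal{V}$, and let $\mathcal{S}$ be its geodesic distance. Let $\mathcal{S}'_{1}$ be the geodesic distance of the first-order subdivision tree $\mathcal{T}'_{1}$ of $\mathcal{T}$. Then $$\mathcal{S}'_{1}=8\mathcal{S}-2|\mathcal{V}|(|\mathcal{V}|-1).$$
   Context: The geodesic distance of a finite connected graph $\mathcal{G}$ with vertex set $\mathcal{V}$ is the total $\mathcal{S}=\sum_{\{u,v\}} d_{uv}$, summed over all unordered pairs of distinct vertices $u,v\in\mathcal{V}$, where $d_{uv}$ is the number of edges of a shortest path joining $u$ and $v$. The first-order subdivision of a graph is the graph obtained by inserting one new vertex into every edge, i.e. replacing every edge $uv$ by a path $uwv$ of length $2$ with a new internal vertex $w$ (a distinct new vertex for each edge). *)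

(* Defs.v *)
From HB Require Import structures.
From mathcomp Require Import all_boot all_order all_algebra.

Set Implicit Arguments.
Unset Strict Implicit.
Unset Printing Implicit Defensive.

(* A finite simple graph is a symmetric irreflexive relation on a finType. *)
Definition simple_graph (V : finType) (e : rel V) : Prop :=
  symmetric e /\ irreflexive e.

Definition connected_graph (V : finType) (e : rel V) : Prop :=
  (0 < #|V|)%N /\ forall u v : V, connect e u v.

(* An edge traversed back and forth is a ucycle of size 2, hence the bound. *)
Definition acyclic_graph (V : finType) (e : rel V) : Prop :=
  forall c : seq V, ucycle e c -> (size c < 3)%N.

Definition is_tree (V : finType) (e : rel V) : Prop :=
  [/\ simple_graph e, connected_graph e & acyclic_graph e].

Definition path_of_length (V : finType) (e : rel V) (u v : V) (n : nat) : bool :=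
  [exists p : n.-tuple V, [&& path e u p, last u p == v & uniq (u :: p)]].

(* Since a path has fewer than #|V| edges, this is the length of a shortest
   path from u to v; the value is #|V| if there is none. *)
Definition graph_dist (V : finType) (e : rel V) (u v : V) : nat :=
  find (path_of_length e u v) (iota 0 #|V|).

(* Comparing ranks selects one ordering of each unordered pair of distinct
   vertices. *)
Definition geodesic_distance (V : finType) (e : rel V) : nat :=
  (\sum_(p : V * V | enum_rank p.1 < enum_rank p.2) graph_dist e p.1 p.2)%N.

Definition edges (V : finType) (e : rel V) : {set {set V}} :=
  [set [set u; v] | u in [set: V], v in [set v | e u v]].

(* The new vertex inserted into an edge is the edge itself. *)
Definition subdiv_vertex (V : finType) (e : rel V) : finType :=
  (V + {A : {set V} | A \in edges e})%type.

Definition subdiv_rel (V : finType) (e : rel V) : rel (subdiv_vertex e) :=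
  fun x y => match x, y with
  | inl u, inr A => u \in val A
  | inr A, inl u => u \in val A
  | _, _ => false
  end.

(* Main.v *)
Require Import Defs.
From HB Require Import structures.
From mathcomp Require Import all_boot all_order all_algebra.
From mathcomp Require Import zify.

(** Write d for the distance of the tree e, d' for that of its subdivision, n for
the number of vertices and m = n - 1 for the number of edges.  Everything is
computed with sums over ordered pairs, which are twice the geodesic distances.

The distances of the subdivision are expressed by d alone
([subdiv_dist_vertex], [subdiv_dist_edge], [subdiv_dist_edge_double]):
- d' u v = 2 d u v for old vertices u and v;
- d' u A = d u a + d u a' for an old vertex u and an edge A = {a, a'}, because
  one end of A is one step further from u than the other;
- 2 d' A B = d a b + d a b' + d a' b + d a' b' for distinct edges A = {a, a'} and
  B = {b, b'}, because the end of A which is further from b is also further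
  from b'; for A = B the right-hand side is 2 instead of 0.
They are checked with [graph_dist_unique]: the distance to u is the only function
that vanishes at u, grows by at most 1 along an edge, and decreases along
some edge at every vertex other than u.

Summing over edges is then summing over vertices: rooting the tree at u, each
v <> u sits on exactly one edge {v, parent v}, and d u (parent v) = d u v - 1.
Hence, with F u the sum of d u v over all v,
  sum_A (d u a + d u a') = sum_(v <> u) (2 d u v - 1) = 2 F u - m
([sum_edges_dist]).  Let D be the sum of the F u, and D1 the sum over u and A of
d' u A, so that D1 = 2 D - n m.  Summing the same identity once more over the ends
of the edges gives 2 D1 - 2 m^2 for the sum of d a b over the ends of all pairs of
edges, so the sum of d' A B is D1 - m^2 - m = D1 - n m.  In all the subdivision has
  2 D + 2 D1 + (D1 - n m) = 8 D - 4 n m,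
which is twice the announced value.

Acyclicity enters only through [tree_nearer_uniq]: a vertex v has at most one
neighbour that is not further from u than v itself. *)

Set Implicit Arguments.
Unset Strict Implicit.
Unset Printing Implicit Defensive.

(** * Distance in a connected graph *)

Section GraphDist.
Variables (V : finType) (e : rel V).
Implicit Types (u v w x y : V) (p : seq V).
Local Notation d := (graph_dist e).

Lemma graph_dist_le_size u p : path e u p -> d u (last u p) <= size p.
Proof.
case/shortenP=> q eq_uq uq sub_qp.
apply: leq_trans (_ : size q <= size p); last first.
  by apply: uniq_leq_size sub_qp; case/andP: uq.
have ltqV: size q < #|V|.
  by have:= max_card (mem (u :: q)); rewrite (card_uniqP uq).
rewrite leqNgt; apply/negP=> /(before_find 0).
rewrite nth_iota // add0n => /existsP[]; exists (in_tuple q).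
by rewrite eq_uq eqxx.
Qed.

Lemma shortest_path u v : connect e u v ->
  exists2 p, path e u p & last u p = v /\ size p = d u v.
Proof.
case/connectP=> p0 e_p0 ->{v}; case/shortenP: e_p0 => q eq_uq uq _.
have ltqV: size q < #|V|.
  by have:= max_card (mem (u :: q)); rewrite (card_uniqP uq).
have: has (path_of_length e u (last u q)) (iota 0 #|V|).
  apply/hasP; exists (size q); first by rewrite mem_iota.
  by apply/existsP; exists (in_tuple q); rewrite eq_uq eqxx.
move=> Phas; have:= nth_find 0 Phas; move: Phas; rewrite has_find size_iota.
move=> ltdV; rewrite nth_iota // add0n => /existsP[p /and3P[e_p /eqP lp _]].
by exists p => //; rewrite size_tuple.
Qed.

Lemma graph_dist_sym : symmetric e -> (forall x y, connect e x y) ->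
  forall u v, d u v = d v u.
Proof.
move=> sym_e conn_e; suff le_d u v: d v u <= d u v.
  by move=> u v; apply/eqP; rewrite eqn_leq !le_d.
have [p e_p [<- <-]] := shortest_path (conn_e u v).
have e_rp: path e (last u p) (rev (belast u p)).
  by rewrite rev_path (eq_path (e' := e)) // => x y; rewrite sym_e.
have:= graph_dist_le_size e_rp; rewrite size_rev size_belast.
suff ->: last (last u p) (rev (belast u p)) = u by [].
by case: (p) => //= x s; rewrite rev_cons last_rcons.
Qed.

Lemma graph_distxx u : d u u = 0.
Proof. by apply/eqP; rewrite -leqn0 (graph_dist_le_size (p := [::])). Qed.

Hypotheses (sym_e : symmetric e) (conn_e : forall x y, connect e x y).

Lemma graph_dist_eq0 u v : (d u v == 0) = (u == v).
Proof.
apply/eqP/eqP=> [d0 | ->]; last exact: graph_distxx.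
have [p _ [lp sp]] := shortest_path (conn_e u v).
by rewrite -lp (size0nil (etrans sp d0)).
Qed.

Lemma graph_dist_step u v w : e v w -> d u w <= (d u v).+1.
Proof.
move=> e_vw; have [p e_p [lp <-]] := shortest_path (conn_e u v).
have:= @graph_dist_le_size u (rcons p w).
by rewrite last_rcons size_rcons rcons_path e_p lp; apply.
Qed.

Lemma graph_dist_descent u v : u != v -> exists2 w, e v w & d u w < d u v.
Proof.
move=> u'v; have [p e_p [lp sp]] := shortest_path (conn_e u v).
case/lastP: p => [|p x] in e_p lp sp; first by rewrite -lp eqxx in u'v.
move: e_p lp sp; rewrite rcons_path last_rcons size_rcons => /andP[e_p e_x] eq_x.
rewrite eq_x in e_x => <-; exists (last u p); first by rewrite sym_e.
by rewrite ltnS graph_dist_le_size.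
Qed.

End GraphDist.

(** A path following the descent of f has at most f x edges, and the bound on the
growth of f makes every path from u to x at least that long.  Connectedness
comes from the descent, so it need not be known beforehand. *)
Lemma graph_dist_unique (V : finType) (e : rel V) (f : V -> nat) u :
    symmetric e -> f u = 0 ->
    (forall x y, e x y -> f y <= (f x).+1) ->
    (forall x, x != u -> exists2 y, e x y & f y < f x) ->
  forall x, graph_dist e u x = f x.
Proof.
move=> sym_e fu0 f_step f_desc x.
have [p e_p [lp le_pf]]:
    exists2 p, path e u p & last u p = x /\ size p <= f x.
  have [n] := ubnP (f x); elim: n x => // n IHn x le_fx.
  have [-> | /f_desc[y e_xy lt_yx]] := eqVneq x u; first by exists [::].
  have [|p e_p [lp le_p]] := IHn y; first exact: leq_trans lt_yx _.
  exists (rcons p x); first by rewrite rcons_path e_p lp sym_e.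
  by rewrite last_rcons size_rcons; split=> //; apply: leq_ltn_trans lt_yx.
apply/eqP; rewrite eqn_leq -{1}lp (leq_trans (graph_dist_le_size e_p)) //=.
have [|q e_q [<- <-]] := @shortest_path _ e u x.
  by apply/connectP; exists p.
elim/last_ind: q e_q => [|q y IHq]; first by rewrite fu0.
rewrite rcons_path last_rcons size_rcons => /andP[/IHq le_q /f_step le_y].
exact: leq_trans le_y _.
Qed.

(** Unlike sums over unordered pairs, these can be split and exchanged freely. *)
Lemma double_geodesic_distance (V : finType) (e : rel V) :
    symmetric e -> (forall x y, connect e x y) ->
  (geodesic_distance e).*2 = \sum_u \sum_v graph_dist e u v.
Proof.
move=> sym_e conn_e; rewrite pair_big /=.
rewrite (bigID (fun q : V * V => enum_rank q.1 < enum_rank q.2)) /=.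
rewrite -addnn; congr (_ + _).
rewrite [RHS](bigID (fun q : V * V => q.1 == q.2)) /= big1 ?add0n; last first.
  by move=> [u v] /andP[_ /eqP/= ->]; rewrite graph_distxx.
have swapK: involutive (fun q : V * V => (q.2, q.1)) by case.
rewrite /geodesic_distance (reindex_inj (inv_inj swapK)) /=.
apply: eq_big => [[u v] | [u v] _] /=; last exact: graph_dist_sym.
rewrite -leqNgt ltn_neqAle andbC; congr (_ && ~~ _).
by apply/eqP/eqP=> [/val_inj/enum_rank_inj|] ->.
Qed.

(** * Distance in a tree *)

Section Tree.
Variables (V : finType) (e : rel V).
Hypothesis tree_e : is_tree e.
Implicit Types (a b u v w : V) (A B : {set V}).
Local Notation d := (graph_dist e).

Lemma tree_sym : symmetric e. Proof. by case: tree_e => -[]. Qed.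
Lemma tree_connect x y : connect e x y. Proof. by case: tree_e => _ []. Qed.
Hint Resolve tree_sym tree_connect : core.

Lemma tree_neq u v : e u v -> u != v.
Proof.
by case: tree_e => -[_ irr_e] _ _; apply: contraL => /eqP->; rewrite irr_e.
Qed.

(** From a neighbour w of v that is not further from u than v, a geodesic to u
cannot meet v. So two such neighbours are joined by a path that avoids v, which
v closes into a cycle. *)
Lemma tree_nearer_uniq u v w1 w2 :
  e v w1 -> e v w2 -> d u w1 <= d u v -> d u w2 <= d u v -> w1 = w2.
Proof.
pose e' := [rel x y | [&& e x y, x != v & y != v]].
have sym_e': symmetric e' by move=> x y /=; rewrite tree_sym [(x != v) && _]andbC.
have conn_e' w: e v w -> d u w <= d u v -> connect e' w u.
  move=> /tree_neq; rewrite eq_sym.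
  have [n] := ubnP (d u w); elim: n w => // n IHn w le_w w'v le_wv.
  have [-> // | u'w] := eqVneq u w.
  have [x e_wx lt_xw] := graph_dist_descent tree_sym tree_connect u'w.
  have x'v: x != v by apply: contraTneq lt_xw => ->; rewrite -leqNgt.
  apply: connect_trans (connect1 _) (IHn x _ x'v _) => /=.
  - by rewrite e_wx w'v.
  - exact: leq_trans lt_xw _.
  exact: leq_trans (ltnW lt_xw) _.
move=> e_v1 e_v2 le1 le2; apply: contraTeq isT => w1'2.
have: connect e' w1 w2.
  apply: connect_trans (conn_e' _ e_v1 le1) _.
  by rewrite (sym_connect_sym sym_e') conn_e'.
case/connectP=> p0 e_p0 def_w2; case/shortenP: e_p0 def_w2 => p e'p up _ def_w2.
have v'p: v \notin w1 :: p.
  rewrite inE negb_or tree_neq //=.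
  elim: (p) (w1) e'p => //= x s IHs y /andP[/and3P[_ _ x'v] /IHs].
  by rewrite inE negb_or eq_sym x'v.
have e_p: path e w1 p by apply: sub_path e'p => x y /and3P[].
case: tree_e => _ _ /(_ [:: v, w1 & p]).
rewrite /ucycle /= rcons_path e_v1 e_p -def_w2 tree_sym e_v2 /=.
rewrite v'p; move: up => /= -> /(_ isT).
by case: (p) def_w2 => //= eq12; rewrite eq12 eqxx in w1'2.
Qed.

(** Trees are bipartite: a neighbour at the same distance would, with the next
vertex on a geodesic, violate [tree_nearer_uniq]. *)
Lemma tree_edge_dist u v w :
  e v w -> d u w = (d u v).+1 \/ d u v = (d u w).+1.
Proof.
move=> e_vw; have le_wv := graph_dist_step tree_connect u e_vw.
have le_vw: d u v <= (d u w).+1.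
  by apply: (graph_dist_step tree_connect); rewrite tree_sym.
have [lt|lt|eq_d] := ltngtP (d u v) (d u w); [by left; lia | by right; lia |].
have [eq_uv | u'v] := eqVneq u v.
  have /eqP := eq_d; rewrite -eq_uv graph_distxx eq_sym.
  rewrite graph_dist_eq0 // eq_uv => /eqP/esym/eqP.
  by rewrite eq_sym (negPf (tree_neq e_vw)).
have [x e_vx lt_xv] := graph_dist_descent tree_sym tree_connect u'v.
have eq_xw: x = w by apply: (tree_nearer_uniq (u := u)) e_vx e_vw _ _; lia.
by move: lt_xv; rewrite eq_xw eq_d ltnn.
Qed.

(** Otherwise a' is further than a from b but nearer to b'. Unless a = b, the next
vertex x from a towards b differs from a', hence is further than a from b', so
d b' x >= d b x + 3, although b and b' are adjacent. So a = b, and then a' = b'. *)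
Lemma tree_edge_separates a a' b b' :
    e a a' -> e b b' -> [set a; a'] != [set b; b'] ->
  d b a' = (d b a).+1 -> d b' a' = (d b' a).+1.
Proof.
move=> e_aa' e_bb' neqAB d_ba'.
have [// | d_b'a] := tree_edge_dist b' e_aa'.
have dist_b x : d x b' <= (d x b).+1 /\ d x b <= (d x b').+1.
  by split; apply: (graph_dist_step tree_connect) => //; rewrite tree_sym.
have dC := graph_dist_sym tree_sym tree_connect.
have [[d1 d2] [d3 d4]] := (dist_b a, dist_b a').
rewrite !(dC a) !(dC a') in d1 d2 d3 d4.
case/eqP: neqAB; have [eq_ba | b'a] := eqVneq b a.
  suff /eqP: d b' a' == 0 by move/eqP; rewrite graph_dist_eq0 // eq_ba => /eqP->.
  by move: d_ba' d_b'a d1; rewrite eq_ba graph_distxx; lia.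
have [x e_ax lt_xa] := graph_dist_descent tree_sym tree_connect b'a.
have [d5 d6] := dist_b x; rewrite !(dC x) in d5 d6.
have eq_xa': x = a' by apply: (tree_nearer_uniq (u := b')) e_ax e_aa' _ _; lia.
by move: lt_xa; rewrite eq_xa' d_ba'; lia.
Qed.

Lemma edgeP A :
  reflect (exists a b, e a b /\ A = [set a; b]) (A \in edges e).
Proof.
apply: (iffP imset2P) => [[a b _] | [a [b [e_ab ->]]]].
  by rewrite inE => e_ab ->; exists a, b.
by exists a b; rewrite ?inE.
Qed.

Lemma sum_edge (g : V -> nat) a b :
  e a b -> \sum_(x in [set a; b]) g x = g a + g b.
Proof. by move/tree_neq=> a'b; rewrite big_setU1 ?big_set1 // inE. Qed.

Lemma edge_orient u A : A \in edges e ->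
  exists a b, [/\ e a b, A = [set a; b] & d u b = (d u a).+1].
Proof.
case/edgeP=> a [b [e_ab ->]]; have [d_ab | d_ba] := tree_edge_dist u e_ab.
  by exists a, b.
by exists b, a; rewrite tree_sym setUC.
Qed.

(** The parent of v when the tree is rooted at u; the default only matters at u. *)
Definition parent u v := odflt v [pick w | e v w && (d u w < d u v)].

Lemma parentP u v : v != u -> e v (parent u v) /\ d u v = (d u (parent u v)).+1.
Proof.
rewrite /parent eq_sym => u'v; case: pickP => [w /andP[e_vw lt_w] | no_w] /=.
  by split=> //; have [] := tree_edge_dist u e_vw; lia.
have [w e_vw lt_w] := graph_dist_descent tree_sym tree_connect u'v.
by have := no_w w; rewrite e_vw lt_w.
Qed.

(** Every edge joins its end further from the root to the parent of that end, and
two vertices are not each other's parents. *)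
Lemma sum_edges_parent u (F : {set V} -> nat) :
  \sum_(A in edges e) F A = \sum_(v | v != u) F [set v; parent u v].
Proof.
have ->: edges e = [set [set v; parent u v] | v in predC1 u].
  apply/setP=> A; apply/idP/imsetP=> [/(edge_orient u)[a [b [e_ab -> d_b]]] | [v]].
    have u'b: b != u by apply: contraPneq d_b => ->; rewrite graph_distxx.
    exists b => //; rewrite setUC; congr [set b; _].
    have [e_bp d_bp] := parentP u'b.
    by apply: (tree_nearer_uniq (u := u)) _ e_bp _ _; rewrite 1?tree_sym //; lia.
  rewrite inE => /parentP[e_vp _] ->.
  by apply/edgeP; exists v, (parent u v).
rewrite big_imset //= => v w /parentP[_ d_v] /parentP[_ d_w] eq_vw.
have: v \in [set w; parent u w] by rewrite -eq_vw !inE eqxx.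
have: w \in [set v; parent u v] by rewrite eq_vw !inE eqxx.
rewrite !inE => /orP[/eqP-> // | /eqP eq_w] /orP[/eqP-> // | /eqP eq_v].
by move: d_v d_w; rewrite -eq_w -eq_v; lia.
Qed.

Lemma card_tree_edges : #|edges e|.+1 = #|V|.
Proof.
have /card_gt0P[u _]: 0 < #|V| by case: tree_e => _ [].
rewrite -sum1_card (sum_edges_parent u) sum1_card [RHS](cardD1 u) add1n.
by congr _.+1; apply: eq_card => x; rewrite !inE andbT.
Qed.

Lemma sum_edges_dist u :
  \sum_(A in edges e) \sum_(a in A) d u a + #|edges e| = (\sum_v d u v).*2.
Proof.
rewrite -sum1_card !(sum_edges_parent u) -big_split /= [in RHS](bigD1 u) //=.
rewrite graph_distxx add0n -muln2 big_distrl; apply: eq_bigr => v /parentP[e_p d_v] /=.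
by rewrite sum_edge // d_v; lia.
Qed.

(** * Distance in the subdivision *)

Local Notation d' := (graph_dist (@subdiv_rel V e)).

Local Notation midpoint edA :=
  (inr (exist (fun A => A \in edges e) _ edA) : subdiv_vertex e).

Lemma subdiv_sym : symmetric (@subdiv_rel V e). Proof. by case=> [u|A] []. Qed.

Lemma subdiv_dist_vertex u (y : subdiv_vertex e) :
  d' (inl u) y = match y with
                 | inl v => (d u v).*2
                 | inr A => \sum_(a in val A) d u a
                 end.
Proof.
move: y; apply: graph_dist_unique subdiv_sym _ _ _ => [|x y e_xy|].
- by rewrite graph_distxx.
- have near v A : A \in edges e -> v \in A ->
    \sum_(a in A) d u a <= (d u v).*2.+1 /\ (d u v).*2 <= (\sum_(a in A) d u a).+1.
    case/(edge_orient u)=> a [b [e_ab -> d_b]]; rewrite sum_edge // d_b.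
    by rewrite !inE => /orP[]/eqP->; rewrite ?d_b; lia.
  by case: x y e_xy => [v|[A edA]] [w|[B edB]] //= /near[].
case=> [v u'v | [A edA] _].
  have{u'v} [e_vp d_v]: e v (parent u v) /\ d u v = (d u (parent u v)).+1.
    by apply: parentP; apply: contraNneq u'v => ->.
  have edA: [set v; parent u v] \in edges e by apply/edgeP; exists v, (parent u v).
  by exists (midpoint edA); rewrite /= ?sum_edge ?inE ?eqxx // d_v; lia.
case/(edge_orient u): (edA) => a [b [e_ab eqA d_b]].
exists (inl a); first by rewrite /= eqA !inE eqxx.
by rewrite /= eqA sum_edge // d_b; lia.
Qed.

Lemma subdiv_connect (x y : subdiv_vertex e) : connect (@subdiv_rel V e) x y.
Proof.
have connC := sym_connect_sym subdiv_sym.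
have conn_vv u v : connect (@subdiv_rel V e) (inl u) (inl v).
  have /connectP[p e_p ->] := tree_connect u v.
  elim: p u e_p => [|w p IHp] u //= /andP[e_uw /IHp]; apply: connect_trans.
  have edA: [set u; w] \in edges e by apply/edgeP; exists u, w.
  by apply: (@connect_trans _ _ (midpoint edA)); apply: connect1;
    rewrite /= !inE eqxx ?orbT.
have [u conn_u] : exists u, forall y, connect (@subdiv_rel V e) (inl u) y.
  have /card_gt0P[u _]: 0 < #|V| by case: tree_e => _ [].
  exists u => -[v // | [A edA]]; have [a [b [_ eqA]]] := edgeP _ edA.
  by apply: connect_trans (conn_vv u a) (connect1 _); rewrite /= eqA !inE eqxx.
by apply: connect_trans (conn_u y); rewrite connC.
Qed.

Lemma sum_dist_edge_mem a B : B \in edges e -> a \in B -> \sum_(b in B) d a b = 1.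
Proof.
case/(edge_orient a)=> b [b' [e_bb' -> d_b']]; rewrite sum_edge // !inE d_b'.
case/orP=> /eqP eq_a; first by rewrite eq_a graph_distxx.
by move: d_b'; rewrite eq_a graph_distxx.
Qed.

(** Seen from both ends of B, the same end of A is the further one; this is where
A and B must be distinct. *)
Lemma edge_orient_edge A B : A \in edges e -> B \in edges e -> A != B ->
  exists a a', [/\ e a a', A = [set a; a'] &
    \sum_(b in B) d a' b = (\sum_(b in B) d a b).+2].
Proof.
move=> edA /edgeP[b [b' [e_bb' ->]]].
case: (edge_orient b edA) => a [a' [e_aa' -> d_a']] A'B; exists a, a'.
split=> //; rewrite !sum_edge // !(graph_dist_sym tree_sym tree_connect a).
rewrite !(graph_dist_sym tree_sym tree_connect a') d_a'.
by rewrite (tree_edge_separates e_aa' e_bb' A'B d_a'); lia.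
Qed.

Lemma subdiv_dist_edge (B : {A | A \in edges e}) (y : subdiv_vertex e) :
  d' (inr B) y = match y with
                 | inl v => \sum_(b in val B) d v b
                 | inr A => if A == B then 0 else
                     (\sum_(a in val A) \sum_(b in val B) d a b)./2
                 end.
Proof.
case: B => B edB /=; pose s a := \sum_(b in B) d a b.
have sB a : a \in B -> s a = 1 by apply: sum_dist_edge_mem.
move: y; apply: graph_dist_unique subdiv_sym _ _ _ => [|x y e_xy|].
- by rewrite eqxx.
- pose h A := if A == B then 0 else (\sum_(a in A) s a)./2.
  have near v A : A \in edges e -> v \in A -> h A <= (s v).+1 /\ s v <= (h A).+1.
    rewrite /h => edA Av; have [eqAB | A'B] := eqVneq A B.
      by rewrite sB -?eqAB.
    have [a [a' [e_aa' eqA s_a']]] := edge_orient_edge edA edB A'B.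
    rewrite -!/(s _) in s_a'.
    rewrite eqA sum_edge // s_a'; move: Av.
    by rewrite eqA !inE => /orP[]/eqP->; rewrite ?s_a'; lia.
  by case: x y e_xy => [v|[A edA]] [w|[C edC]] //= /near[] //; rewrite /h.
case=> [v _ | [A edA]].
  have [Bv | B'v] := boolP (v \in B).
    by exists (midpoint edB) => //=; rewrite eqxx -/(s v) sB.
  (* One step towards an end b of B is also a step towards its other end. *)
  have [b Bb] : exists b, b \in B.
    by have [b [b' [_ ->]]] := edgeP _ edB; exists b; rewrite !inE eqxx.
  have v'b: v != b by apply: contraNneq B'v => ->.
  have [e_vp d_v] := parentP v'b.
  have edA: [set v; parent b v] \in edges e by apply/edgeP; exists v, (parent b v).
  have A'B: [set v; parent b v] != B by apply: contraNneq B'v => <-; rewrite !inE eqxx.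
  exists (midpoint edA); rewrite /= ?inE ?eqxx //.
  rewrite ifN // sum_edge // -!/(s _).
  have [b' [e_bb' eqB]] : exists b', e b b' /\ B = [set b; b'].
    have [c [c' [e_cc' eqB]]] := edgeP _ edB.
    move: Bb; rewrite eqB !inE => /orP[]/eqP->; first by exists c'.
    by exists c; rewrite tree_sym setUC.
  have:= @tree_edge_separates (parent b v) v b b'.
  rewrite tree_sym -eqB setUC => /(_ e_vp e_bb' A'B d_v).
  rewrite /s eqB !sum_edge // !(graph_dist_sym tree_sym tree_connect v).
  by rewrite !(graph_dist_sym tree_sym tree_connect (parent b v)); lia.
move=> A'B; have {}A'B: A != B.
  by apply: contraNneq A'B => eqAB; apply/eqP; congr inr; apply: val_inj.
have [a [a' [e_aa' eqA s_a']]] := edge_orient_edge edA edB A'B.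
rewrite -!/(s _) in s_a'.
exists (inl a); first by rewrite /= eqA !inE eqxx.
rewrite /= ifN // eqA sum_edge // -!/(s _) s_a'; lia.
Qed.

(** Doubling removes the half, and the extra term removes the exception for A = B:
the right-hand side can be summed over all pairs of edges. *)
Lemma subdiv_dist_edge_double (A B : {A | A \in edges e}) :
  (d' (inr B) (inr A)).*2 + (A == B).*2 =
    \sum_(a in val A) \sum_(b in val B) d a b.
Proof.
rewrite subdiv_dist_edge; have [-> | A'B] := eqVneq A B.
  rewrite (eq_bigr (fun=> 1)) => [|a Ba]; last exact: sum_dist_edge_mem (valP B) Ba.
  by have [a [b [e_ab ->]]] := edgeP _ (valP B); rewrite sum_edge.
rewrite addn0; have [a [b [e_ab eqA s_b]]] := edge_orient_edge (valP A) (valP B) A'B.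
by rewrite eqA sum_edge // s_b; lia.
Qed.

Lemma sum_edge_vertices (F : {set V} -> nat) :
  \sum_(A : {A | A \in edges e}) F (val A) = \sum_(A in edges e) F A.
Proof.
rewrite -(big_imset (h := val) (A := predT)) /=; last by move=> A B _ _ /val_inj.
apply: eq_bigl => A; apply/imsetP/idP=> [[B _ ->] | edA]; first exact: valP.
by exists (Sub A edA).
Qed.

(** * Summation *)

(** Subtractions are avoided: every correction term is moved to the other side. *)
Lemma sum_subdiv_dist :
  \sum_x \sum_y d' x y + 4 * (#|V| * #|edges e|) = 8 * \sum_u \sum_v d u v.
Proof.
pose D := \sum_u \sum_v d u v.
pose D1 := \sum_u \sum_(A in edges e) \sum_(a in A) d u a.
pose D2 := \sum_(A in edges e) \sum_(a in A) \sum_(B in edges e) \sum_(b in B) d a b.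
have D1E : D1 + #|V| * #|edges e| = D.*2.
  have <-: \sum_(u : V) #|edges e| = #|V| * #|edges e| by rewrite sum_nat_const.
  rewrite /D1 /D -big_split -muln2 big_distrl.
  by apply: eq_bigr => u _ /=; rewrite sum_edges_dist muln2.
have edge2 (k : nat) : \sum_(A in edges e) \sum_(a in A) k = #|edges e| * k.*2.
  rewrite -sum_nat_const; apply: eq_bigr => A /edgeP[a [b [e_ab ->]]].
  by rewrite sum_edge ?addnn.
have D2E : D2 + #|edges e| * #|edges e|.*2 = D1.*2.
  rewrite -edge2 /D2 -big_split -muln2 /D1 [in RHS]exchange_big big_distrl.
  apply: eq_bigr => A _ /=; rewrite [in RHS]exchange_big -big_split big_distrl.
  apply: eq_bigr => a _; rewrite /= sum_edges_dist muln2; congr _.*2.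
  by apply: eq_bigr => v _; apply: graph_dist_sym.
rewrite big_sumType /=.
have -> : \sum_u \sum_y d' (inl u) y = D.*2 + D1.
  rewrite /D -muln2 big_distrl -big_split; apply: eq_bigr => u _.
  rewrite big_sumType -(sum_edge_vertices (fun A => \sum_(a in A) d u a)) /= big_distrl.
  congr (_ + _); apply: eq_bigr => ? _; rewrite subdiv_dist_vertex //.
  by rewrite /= muln2.
pose D' := \sum_(B : {A | A \in edges e})
  \sum_(A : {A | A \in edges e}) d' (inr B) (inr A).
have -> : \sum_(B : {A | A \in edges e}) \sum_y d' (inr B) y = D1 + D'.
  rewrite /D1 [in RHS]exchange_big.
  rewrite -(sum_edge_vertices (fun A => \sum_u \sum_(a in A) d u a)) -big_split.
  apply: eq_bigr => B _; rewrite big_sumType; congr (_ + _).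
  by apply: eq_bigr => u _; rewrite subdiv_dist_edge.
have D'E : D'.*2 + #|edges e|.*2 = D2.
  have ->: D2 = \sum_(A : {A | A \in edges e}) \sum_(B : {A | A \in edges e})
      ((d' (inr B) (inr A)).*2 + (A == B).*2).
    rewrite /D2 -(sum_edge_vertices
      (fun A => \sum_(a in A) \sum_(B in edges e) \sum_(b in B) d a b)).
    apply: eq_bigr => A _; rewrite exchange_big /= -(sum_edge_vertices
      (fun B => \sum_(a in val A) \sum_(b in B) d a b)).
    by apply: eq_bigr => B _; rewrite subdiv_dist_edge_double.
  rewrite /D' exchange_big -sum1_card -!muln2 !big_distrl /=.
  rewrite -(sum_edge_vertices (fun=> 2)) -big_split; apply: eq_bigr => A _.
  rewrite big_split /= big_distrl; congr (_ + _).
    by apply: eq_bigr => B _; rewrite /= muln2.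
  by rewrite (bigD1 A) //= eqxx big1 // => B /negPf; rewrite eq_sym => ->.
rewrite -/D; move: D1E D2E D'E; rewrite -card_tree_edges.
move: D D1 D2 D' #|edges e| => D D1 D2 D' m; rewrite -!muln2 !mulSn mulnA; lia.
Qed.

End Tree.

Theorem theorem1 (V : finType) (e : rel V) (tree_e : is_tree e) :
  ((geodesic_distance (@subdiv_rel V e))%:Z =
     8 * (geodesic_distance e)%:Z - 2 * #|V|%:Z * (#|V|%:Z - 1) :> int)%R.
Proof.
have S'E := double_geodesic_distance (@subdiv_sym V e) (subdiv_connect tree_e).
have SE := double_geodesic_distance (tree_sym tree_e) (tree_connect tree_e).
have := sum_subdiv_dist tree_e; have := card_tree_edges tree_e.
rewrite -S'E -SE; nia.
Qed.
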